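(* If $A$ and $B$ are two $5\times 5$ Hadamard matrices in dephased form, and $\operatorname{tr}(A)=\operatorname{tr}(B)$, then $A$ and $B$ are spectrally equivalent.
   Context: An $n\times n$ complex matrix $H$ is called a Hadamard matrix if it is unitary ($HH^*=H^*H=I_n$) and all its entries have complex modulus $\frac{1}{\sqrt n}$. A Hadamard matrix is in dephased form if all entries of its first row and of its first column are equal to $\frac{1}{\sqrt n}$. Two matrices are spectrally equivalent if their spectra are equal including multiplicity (for the unitary matrices considered here, equivalently $A=U^*BU$ for some unitary $U$). *)

(* Defs.v *)
From mathcomp Require Import all_boot all_order all_algebra.
From mathcomp Require Import reals complex.

Set Implicit Arguments.
Unset Strict Implicit.
Unset Printing Implicit Defensive.

Import Order.TTheory GRing.Theory Num.Theory.
Local Open Scope ring_scope.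
Local Open Scope sesquilinear_scope.

(* The entries have modulus 1 / sqrt n: H is normalized so that it is unitary,
   as opposed to having unimodular entries. *)
Definition hadamard (C : numClosedFieldType) (n : nat) (H : 'M[C]_n) : Prop :=
  H \is unitarymx /\ forall i j, `|H i j| = 1 / sqrtC n%:R.

(* [unitarymx] only asks for a right inverse, as it also covers rectangular
   matrices; for square matrices this is the usual two-sided condition. *)
Lemma unitarymx_two_sided (C : numClosedFieldType) (n : nat) (H : 'M[C]_n) :
  H \is unitarymx <-> H *m H^t* = 1%:M /\ H^t* *m H = 1%:M.
Proof.
split=> [/unitarymxP HH|[/unitarymxP]//].
by split=> //; apply: mulmx1C.
Qed.

Definition dephased (C : numClosedFieldType) (n : nat) (H : 'M[C]_n.+1) : Prop :=
  (forall j, H ord0 j = 1 / sqrtC n.+1%:R) /\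
  (forall i, H i ord0 = 1 / sqrtC n.+1%:R).

(* The algebraic multiplicity of z; it is 0 when z is not an eigenvalue. *)
Definition eigen_mult (F : fieldType) (n : nat) (A : 'M[F]_n) (z : F) : nat :=
  mup z (char_poly A).

Definition spectrally_equivalent (C : numClosedFieldType) (n : nat)
    (A B : 'M[C]_n) : Prop :=
  forall z : C, eigen_mult A z = eigen_mult B z.

(* Main.v *)
Require Import Defs.
From mathcomp Require Import all_boot all_order all_algebra.
From mathcomp Require Import reals complex.
From mathcomp Require Import all_fingroup ring zify.

(** The proof goes through Haagerup's uniqueness of the Hadamard matrix of
    order 5.  Scale the entries to modulus 1, so that conjugation is inversion.
    In three rows, let U, V, W be the partial inner products over two columns.
    Then UVW = |U|^2 + |V|^2 + |W|^2 - 4, and by orthogonality -U, -V, -W are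
    the partial inner products over the other three columns.  Comparing the
    resulting identity for a 3x3 submatrix with those for its transpose and its
    conjugate shows that two of its three even permutation products coincide,
    and likewise two of the odd ones.  After a change of base row and base
    column the submatrix is therefore [1 1 1; 1 a b; 1 b a]; its completions are
    few, because t + 1/t = -3 is impossible on the unit circle, and the same
    dichotomy applied to them forces a^5 = 1.  So a dephased matrix has fifth
    roots of unity as entries.  The powers of a primitive fifth root satisfy
    only one linear relation over the integers, hence orthogonality makes all
    differences of rows of exponents permutations of Z/5.  This leaves 144
    tables of exponents, and among these any two with the same diagonal up to
    order, that is with the same trace, agree up to transposition and
    a simultaneous permutation of rows and columns. *)

Set Implicit Arguments.
Unset Strict Implicit.
Unset Printing Implicit Defensive.

Import Order.TTheory GRing.Theory Num.Theory.
Local Open Scope ring_scope.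

(** * Corners of size three *)

(** The product identity for two-term sums is applied to the two columns outside the corner;
    orthogonality turns each of its six sums into minus a sum over the corner. Inverses stand for
    conjugates. *)
Lemma triple_prod_corner (F : fieldType) (a b c d x y z w : F) :
  a != 0 -> b != 0 -> c != 0 -> d != 0 ->
  x != 0 -> y != 0 -> z != 0 -> w != 0 ->
  1 + a + b + x + y = 0 -> 1 + a^-1 + b^-1 + x^-1 + y^-1 = 0 ->
  1 + c + d + z + w = 0 -> 1 + c^-1 + d^-1 + z^-1 + w^-1 = 0 ->
  1 + a / c + b / d + x / z + y / w = 0 ->
  1 + c / a + d / b + z / x + w / y = 0 ->
  (1 + a^-1 + b^-1) * (1 + a / c + b / d) * (1 + c + d) =
  4 - (1 + a + b) * (1 + a^-1 + b^-1) - (1 + c + d) * (1 + c^-1 + d^-1)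
    - (1 + a / c + b / d) * (1 + c / a + d / b).
Proof.
move=> a0 b0 c0 d0 x0 y0 z0 w0 e1 e1' e2 e2' e3 e3'.
have gram : (x^-1 + y^-1) * (x / z + y / w) * (z + w) =
    (x + y) * (x^-1 + y^-1) + (z + w) * (z^-1 + w^-1) +
    (x / z + y / w) * (z / x + w / y) - 4.
  by field; rewrite x0 y0 z0 w0.
have neg (s p q : F) : s + p + q = 0 -> p + q = - s.
  by move=> /eqP; rewrite -addrA addrC addr_eq0 => /eqP.
move: gram; rewrite (neg _ _ _ e1) (neg _ _ _ e1') (neg _ _ _ e2).
rewrite (neg _ _ _ e2') (neg _ _ _ e3) (neg _ _ _ e3') !mulNr !mulrN !opprK => /eqP.
rewrite -subr_eq0 => /eqP gram; apply/eqP.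
by rewrite -subr_eq0 -oppr_eq0 -gram; apply/eqP; ring.
Qed.

(* The three instances of [triple_prod_corner] for the corner
   [1 1 1; 1 a b; 1 c d], its transpose and its conjugate.  The even permutation
   products are a d, b, c, and the odd ones b c, a, d. *)
Lemma corner_dichotomy (F : fieldType) (a b c d : F) :
  a != 0 -> b != 0 -> c != 0 -> d != 0 ->
  let T a b c d := (1 + a^-1 + b^-1) * (1 + a / c + b / d) * (1 + c + d) in
  let S a b c d := 4 - (1 + a + b) * (1 + a^-1 + b^-1)
    - (1 + c + d) * (1 + c^-1 + d^-1)
    - (1 + a / c + b / d) * (1 + c / a + d / b) in
  T a b c d = S a b c d -> T a c b d = S a c b d ->
  T a^-1 b^-1 c^-1 d^-1 = S a^-1 b^-1 c^-1 d^-1 ->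
  [\/ b = c, a * d = b | a * d = c] /\ [\/ a = d, b * c = a | b * c = d].
Proof.
move=> a0 b0 c0 d0 T S; rewrite {}/T {}/S !invrK => er ec ei.
have nz3 (p q r : F) : (p - q) * (r - p) * (r - q) = 0 -> [\/ p = q, r = p | r = q].
  by move/eqP; rewrite !mulf_eq0 !subr_eq0 -orbA => /or3P[]/eqP->;
    [apply: Or31|apply: Or32|apply: Or33].
have sub0 (p q : F) : p = q -> p - q = 0 by move=> ->; rewrite subrr.
move: (sub0 _ _ er) (sub0 _ _ ec) (sub0 _ _ ei) => {}er {}ec {}ei.
split; apply: nz3.
  (* Times a b c d, the difference of the first two instances is (b - c)(a d - b)(a d - c). *)
  have := congr1 ( *%R (a * b * c * d)) (congr2 (fun u v => u - v) er ec).
  by rewrite subrr mulr0 => <- /=; field; rewrite c0 a0 d0 b0.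
(* The last two instances give (a - d)(b c - a)(b c - d) in the same way. *)
have := congr1 ( *%R (a * b * c * d)) (congr2 (fun u v => u - v) ec ei).
by rewrite subrr mulr0 => <- /=; field; rewrite ?a0 ?b0 ?c0 ?d0.
Qed.

(** * Unimodular Hadamard matrices of order five *)

Lemma ord5_ind (P : 'I_5 -> Prop) :
  P 0 -> P 1 -> P 2 -> P 3 -> P 4 -> forall i, P i.
Proof.
move=> P0 P1 P2 P3 P4 [m lt_m5].
case: m lt_m5 => [|[|[|[|[|//]]]]] lt_m5.
- by rewrite (_ : Ordinal _ = 0) //; apply: val_inj.
- by rewrite (_ : Ordinal _ = 1) //; apply: val_inj.
- by rewrite (_ : Ordinal _ = 2) //; apply: val_inj.
- by rewrite (_ : Ordinal _ = 3) //; apply: val_inj.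
- by rewrite (_ : Ordinal _ = 4) //; apply: val_inj.
Qed.

Lemma sum_ord5 (V : nmodType) (f : 'I_5 -> V) :
  \sum_i f i = f 0 + f 1 + f 2 + f 3 + f 4.
Proof.
rewrite 4!big_ord_recr big_ord1 /=.
by congr (f _ + f _ + f _ + f _ + f _); apply: val_inj.
Qed.

(* Excludes the solutions of Potts type, t + 1/t = -3, which satisfy all the
   algebraic identities below but are not unimodular. *)
Lemma neq_inv_unimodular (C : numFieldType) (t : C) : `|t| = 1 -> 3 + t + t^-1 != 0.
Proof.
move=> t1; rewrite -addrA addr_eq0; apply/negP => /eqP/(congr1 Num.norm).
rewrite normrN normr_nat => le3.
have := ler_normD t t^-1; rewrite -le3 normfV t1 invr1.
by rewrite -natr1 gerDl ler10.
Qed.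

Lemma unimodular_neq0 (C : numFieldType) (t : C) : `|t| = 1 -> t != 0.
Proof. by move=> t1; rewrite -normr_eq0 t1 oner_neq0. Qed.

(* Division stands for the product with the conjugate, as entries have modulus 1. *)
Definition hadamard5 (C : numFieldType) (h : 'I_5 -> 'I_5 -> C) : Prop :=
  [/\ forall i j, `|h i j| = 1,
      forall i k, i != k -> \sum_j h i j / h k j = 0
    & forall j l, j != l -> \sum_i h i j / h i l = 0].

Definition normal5 (C : numFieldType) (h : 'I_5 -> 'I_5 -> C) : Prop :=
  (forall j, h 0 j = 1) /\ (forall i, h i 0 = 1).

Definition dephase (C : numFieldType) (h : 'I_5 -> 'I_5 -> C) i j : C :=
  h i j * h 0 0 / (h i 0 * h 0 j).

Lemma hadamard5_neq0 (C : numFieldType) (h : 'I_5 -> 'I_5 -> C) i j :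
  hadamard5 h -> h i j != 0.
Proof. by case=> h1 _ _; apply: unimodular_neq0. Qed.

Lemma hadamard5_tr (C : numFieldType) (h : 'I_5 -> 'I_5 -> C) :
  hadamard5 h -> hadamard5 (fun i j => h j i).
Proof. by case=> h1 hr hc; split. Qed.

Lemma hadamard5_perm (C : numFieldType) (h : 'I_5 -> 'I_5 -> C) (s t : 'S_5) :
  hadamard5 h -> hadamard5 (fun i j => h (s i) (t j)).
Proof.
case=> h1 hr hc; split=> // [i k ik|j l jl].
  rewrite -(reindex_inj (@perm_inj _ t) (P := xpredT)
    (F := fun j => h (s i) j / h (s k) j)).
  by rewrite hr // (inj_eq perm_inj).
rewrite -(reindex_inj (@perm_inj _ s) (P := xpredT)
  (F := fun i => h i (t j) / h i (t l))).
by rewrite hc // (inj_eq perm_inj).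
Qed.

Lemma hadamard5_dephase (C : numFieldType) (h : 'I_5 -> 'I_5 -> C) :
  hadamard5 h -> hadamard5 (dephase h).
Proof.
move=> hh; case: (hh) => h1 hr hc; split=> [i j|i k ik|j l jl].
- by rewrite /dephase !(normrM, normfV) !h1 !mulr1 divr1.
- transitivity ((h k 0 / h i 0) * \sum_j h i j / h k j); last by rewrite hr // mulr0.
  rewrite mulr_sumr; apply: eq_bigr => j _; rewrite /dephase.
  by field; rewrite !hadamard5_neq0.
- transitivity ((h 0 l / h 0 j) * \sum_i h i j / h i l); last by rewrite hc // mulr0.
  rewrite mulr_sumr; apply: eq_bigr => i _; rewrite /dephase.
  by field; rewrite !hadamard5_neq0.
Qed.

Lemma normal5_dephase (C : numFieldType) (h : 'I_5 -> 'I_5 -> C) :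
  hadamard5 h -> normal5 (dephase h).
Proof.
by move=> hh; split=> k; rewrite /dephase; field; rewrite !hadamard5_neq0.
Qed.

Lemma normal5_tr (C : numFieldType) (h : 'I_5 -> 'I_5 -> C) :
  normal5 h -> normal5 (fun i j => h j i).
Proof. by case. Qed.

Lemma row_orth (C : numFieldType) (g : 'I_5 -> 'I_5 -> C) i k :
  hadamard5 g -> normal5 g -> i != k ->
  1 + g i 1 / g k 1 + g i 2 / g k 2 + g i 3 / g k 3 + g i 4 / g k 4 = 0.
Proof.
move=> [_ hr _] [_ g0] ik.
by rewrite -(hr i k ik) sum_ord5 !g0 divr1.
Qed.

Lemma row_sum (C : numFieldType) (g : 'I_5 -> 'I_5 -> C) i :
  hadamard5 g -> normal5 g -> i != 0 -> 1 + g i 1 + g i 2 + g i 3 + g i 4 = 0.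
Proof. by move=> hg ng /(row_orth hg ng); rewrite !(proj1 ng) !divr1. Qed.

Lemma row_sumV (C : numFieldType) (g : 'I_5 -> 'I_5 -> C) i :
  hadamard5 g -> normal5 g -> i != 0 ->
  1 + (g i 1)^-1 + (g i 2)^-1 + (g i 3)^-1 + (g i 4)^-1 = 0.
Proof.
by move=> hg ng; rewrite eq_sym => /(row_orth hg ng); rewrite !(proj1 ng) !mul1r.
Qed.

Lemma corner_dichotomy5 (C : numFieldType) (g : 'I_5 -> 'I_5 -> C) :
  hadamard5 g -> normal5 g ->
  let a := g 1 1 in let b := g 1 2 in let c := g 2 1 in let d := g 2 2 in
  [\/ b = c, a * d = b | a * d = c] /\ [\/ a = d, b * c = a | b * c = d].
Proof.
move=> hg ng a b c d.
have nz i j : g i j != 0 by apply: hadamard5_neq0.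
have [r s sV] := And3 (fun i k => @row_orth _ g i k hg ng)
  (fun i => @row_sum _ g i hg ng) (fun i => @row_sumV _ g i hg ng).
have [hg' ng'] := (hadamard5_tr hg, normal5_tr ng).
have [r' s' sV'] := And3 (fun i k => @row_orth _ _ i k hg' ng')
  (fun i => @row_sum _ _ i hg' ng') (fun i => @row_sumV _ _ i hg' ng').
apply: corner_dichotomy; rewrite ?nz //.
- by apply: (triple_prod_corner (x := g 1 3) (y := g 1 4) (z := g 2 3) (w := g 2 4));
    rewrite ?nz ?s ?sV ?r.
(* The transposed corner is completed by rows 3 and 4 in place of columns 3 and 4. *)
- by apply: (triple_prod_corner (x := g 3 1) (y := g 4 1) (z := g 3 2) (w := g 4 2));
    rewrite ?nz ?(s' 1) ?(s' 2) ?(sV' 1) ?(sV' 2) ?(r' 1 2) ?(r' 2 1).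
- by apply: (triple_prod_corner (x := (g 1 3)^-1) (y := (g 1 4)^-1)
       (z := (g 2 3)^-1) (w := (g 2 4)^-1));
    rewrite ?invr_eq0 ?nz ?invrK ?s ?sV // ![_^-1 * _]mulrC r.
Qed.

(** * Circulant corners *)

Lemma neq_ratio_unimodular (C : numFieldType) (u v : C) :
  `|u| = 1 -> `|v| = 1 -> 3 + u / v + v / u <> 0.
Proof.
move=> u1 v1; have := @neq_inv_unimodular C (u / v).
by rewrite normrM normfV u1 v1 divr1 invf_div => /(_ erefl)/eqP.
Qed.

(** As the common sum is nonzero, equal sums of inverses give equal products, so both pairs are the
    roots of one quadratic. *)
Lemma pair_eq_of_sums (F : fieldType) (x y z w : F) :
  x != 0 -> y != 0 -> z != 0 -> w != 0 -> x + y != 0 ->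
  x + y = z + w -> x^-1 + y^-1 = z^-1 + w^-1 ->
  z = x /\ w = y \/ z = y /\ w = x.
Proof.
move=> x0 y0 z0 w0 xy0 s si.
have inv_sum (p q : F) : p != 0 -> q != 0 -> p^-1 + q^-1 = (p + q) / (p * q).
  by move=> p0 q0; field; rewrite p0 q0.
move: si; rewrite !inv_sum // -s => /(mulfI xy0)/invr_inj pr.
have : (z - x) * (z - y) = 0.
  transitivity (z ^+ 2 - (x + y) * z + x * y); first by ring.
  by rewrite s pr; ring.
move=> /eqP; rewrite mulf_eq0 !subr_eq0 => /orP[]/eqP zE; [left|right]; split=> //.
  by apply: (addrI x); rewrite s zE.
by apply: (addrI y); rewrite [RHS]addrC s zE.
Qed.

Lemma last_two_of_sum (F : fieldType) (p q s : F) : s + p + q = 0 -> p + q = - s.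
Proof. by move=> /eqP; rewrite -addrA addrC addr_eq0 => /eqP. Qed.

(** Both pairs have the same sum and the same sum of inverses. If x + y = 0, then a and b are the
    primitive cube roots of unity and orthogonality leaves 2 x / z = 0. Otherwise the pairs agree up
    to order, and the same order would give 3 + a / b + b / a = 0. *)
Lemma swapped_pair (C : numFieldType) (a b x y z w : C) :
  `|a| = 1 -> `|b| = 1 -> `|x| = 1 -> `|y| = 1 -> `|z| = 1 -> `|w| = 1 ->
  1 + a + b + x + y = 0 -> 1 + a^-1 + b^-1 + x^-1 + y^-1 = 0 ->
  1 + b + a + z + w = 0 -> 1 + b^-1 + a^-1 + z^-1 + w^-1 = 0 ->
  1 + a / b + b / a + x / z + y / w = 0 ->
  [/\ x + y != 0, z = y & w = x].
Proof.
move=> a1 b1 x1 y1 z1 w1 e ei f fi o.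
have a0 := unimodular_neq0 a1; have b0 := unimodular_neq0 b1.
have x0 := unimodular_neq0 x1; have y0 := unimodular_neq0 y1.
have z0 := unimodular_neq0 z1; have w0 := unimodular_neq0 w1.
have s : x + y = z + w.
  by rewrite (last_two_of_sum e) (last_two_of_sum f); congr (- _); ring.
have si : x^-1 + y^-1 = z^-1 + w^-1.
  by rewrite (last_two_of_sum ei) (last_two_of_sum fi); congr (- _); ring.
have xy0 : x + y != 0.
  apply/negP => /eqP xy; have zw : z + w = 0 by rewrite -s.
  have yE : y = - x by apply/eqP; rewrite -addr_eq0 addrC xy.
  have wE : w = - z by apply/eqP; rewrite -addr_eq0 addrC zw.
  have ab : 1 + a + b = 0 by rewrite -[LHS]opprK -(last_two_of_sum e) xy oppr0.
  have abi : 1 + a^-1 + b^-1 = 0.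
    by rewrite -[LHS]opprK -(last_two_of_sum ei) yE; field.
  have ab1 : a * b = 1.
    have : a * b * (1 + a^-1 + b^-1) = 0 by rewrite abi mulr0.
    have -> : a * b * (1 + a^-1 + b^-1) = a * b - 1 + (1 + a + b).
      by field; rewrite a0 b0.
    by rewrite ab addr0 => /eqP; rewrite subr_eq0 => /eqP.
  have tr0 : 1 + a / b + b / a = 0.
    have -> : 1 + a / b + b / a = ((1 + a + b - 1) ^+ 2 - a * b) / (a * b).
      by field; rewrite a0 b0.
    by rewrite ab ab1 add0r sqrrN expr1n subrr mul0r.
  have : x / z *+ 2 = 0.
    by rewrite -o tr0 add0r yE wE invrN mulrNN mulr2n.
  by move/eqP; rewrite mulrn_eq0 /= mulf_eq0 invr_eq0 (negPf x0) (negPf z0).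
have [[zE wE]|[-> ->]] := pair_eq_of_sums x0 y0 z0 w0 xy0 s si; last by split.
case: (neq_ratio_unimodular a1 b1); rewrite -[RHS]o zE wE !divff ?nz //; ring.
Qed.

(** Distinctness discards the first alternative of each dichotomy. Of the sixteen choices left, two
    are consistent: a, then x and y in one of the orders, then b are a, a^2, a^3, a^4 with a^5 = 1.
    All others make two entries coincide. *)
Lemma cyclic_monomials (C : numFieldType) (a b x y : C) :
  `|a| = 1 -> `|b| = 1 -> `|x| = 1 -> `|y| = 1 -> x + y != 0 -> a + b != 0 ->
  uniq [:: a; b; x; y] ->
  [\/ x = b, a * y = x | a * y = b] -> [\/ a = y, x * b = a | x * b = y] ->
  [\/ y = b, a * x = y | a * x = b] -> [\/ a = x, y * b = a | y * b = x] ->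
  [/\ a ^+ 5 = 1, b ^+ 5 = 1, x ^+ 5 = 1 & y ^+ 5 = 1].
Proof.
move=> a1 b1 x1 y1 xy0 ab0.
have a0 := unimodular_neq0 a1; have b0 := unimodular_neq0 b1.
have x0 := unimodular_neq0 x1; have y0 := unimodular_neq0 y1.
rewrite /= !inE !negb_or => /and4P[/and3P[nab nax nay] /andP[nbx nby] nxy _].
have invol (u v w : C) :
    u != 0 -> v + w != 0 -> v != w -> u * v = w -> u * w = v -> False.
  move=> u0 vw0 nvw uv uw.
  have : (u - 1) * (v + w) = 0 by rewrite mulrDr !mulrBl uv uw; ring.
  move/eqP; rewrite mulf_eq0 (negPf vw0) orbF subr_eq0 => /eqP u1.
  by move: uv nvw; rewrite u1 mul1r => ->; rewrite eqxx.
have one5 (v w : C) : v != 0 ->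
    a * v = w -> a * w = b -> v * b = a -> w * b = v ->
    [/\ a ^+ 5 = 1, b ^+ 5 = 1, v ^+ 5 = 1 & w ^+ 5 = 1].
  move=> v0 aw ab va wv.
  have av2 : a * v ^+ 2 = 1 by apply: (mulfI a0); rewrite mulr1 -[RHS]va -ab -aw; ring.
  have vE : v = a ^+ 2.
    by rewrite -wv -ab -aw (_ : _ * _ = a ^+ 2 * (a * v ^+ 2)); [rewrite av2 mulr1|ring].
  have a5 : a ^+ 5 = 1 by rewrite -[RHS]av2 vE; ring.
  by split=> //; rewrite -?ab -?aw vE -?exprS -exprM mulnC exprM a5 expr1n.
case=> [xb|ayx|ayb]; first by rewrite xb eqxx in nbx.
  case=> [ay|xba|xby]; first by rewrite ay eqxx in nay.
    case=> [yb|axy|axb]; first by rewrite yb eqxx in nby.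
      by case: (invol a x y).
    case=> [ax|yba|ybx]; first by rewrite ax eqxx in nax.
      by move: nxy; rewrite (mulIf b0 (etrans xba (esym yba))) eqxx.
    by move: nab; rewrite (mulIf y0 (etrans ayx (esym (etrans (mulrC _ _) ybx)))) eqxx.
  case=> [yb|axy|axb]; first by rewrite yb eqxx in nby.
    by case: (invol a x y).
  case=> [ax|yba|ybx]; first by rewrite ax eqxx in nax.
    by have [] := one5 y x y0 ayx axb yba xby.
  by case: (invol b x y b0 xy0 nxy); rewrite mulrC.
case=> [ay|xba|xby]; first by rewrite ay eqxx in nay.
  case=> [yb|axy|axb]; first by rewrite yb eqxx in nby.
    case=> [ax|yba|ybx]; first by rewrite ax eqxx in nax.
      by move: nxy; rewrite (mulIf b0 (etrans xba (esym yba))) eqxx.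
    by have [] := one5 x y x0 axy ayb xba ybx.
  by move: nxy; rewrite (mulfI a0 (etrans axb (esym ayb))) eqxx.
case=> [yb|axy|axb]; first by rewrite yb eqxx in nby.
  by move: nab; rewrite (mulIf x0 (etrans axy (esym (etrans (mulrC _ _) xby)))) eqxx.
by move: nxy; rewrite (mulfI a0 (etrans axb (esym ayb))) eqxx.
Qed.

Lemma circulant_corner_rows (C : numFieldType) (g : 'I_5 -> 'I_5 -> C) :
  hadamard5 g -> normal5 g -> g 1 1 = g 2 2 -> g 1 2 = g 2 1 ->
  [/\ g 1 3 + g 1 4 != 0, g 2 3 = g 1 4 & g 2 4 = g 1 3].
Proof.
move=> hg ng ad bc; have [g1 _ _] := hg.
apply: (swapped_pair (a := g 1 1) (b := g 1 2)); rewrite ?g1 //.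
- exact: (row_sum hg ng (i := 1)).
- exact: (row_sumV hg ng (i := 1)).
- by rewrite bc ad; apply: (row_sum hg ng (i := 2)).
- by rewrite bc ad; apply: (row_sumV hg ng (i := 2)).
- by rewrite {2}ad {1}bc; apply: (row_orth hg ng (i := 1) (k := 2)).
Qed.

(** Below the first row and beside the first column, the matrix has rows a b x y, b a y x, x y p q
    and y x q p, where p, q are a, b in some order. Once a, b, x, y are known to be distinct, the
    corner dichotomy yields fifth roots of unity. *)
Lemma aligned_circulant_corner (C : numFieldType) (g : 'I_5 -> 'I_5 -> C) :
  hadamard5 g -> normal5 g -> g 1 1 = g 2 2 -> g 1 2 = g 2 1 -> g 1 3 = g 3 1 ->
  forall i j, g i j ^+ 5 = 1.
Proof.
move=> hg ng ad bc xp.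
have [g1 _ _] := hg.
have nz i j : g i j != 0 by apply: hadamard5_neq0.
have [hg' ng'] := (hadamard5_tr hg, normal5_tr ng).
set a := g 1 1 in ad *; set b := g 1 2 in bc *; set x := g 1 3 in xp *; set y := g 1 4.
have r1 : 1 + a + b + x + y = 0 := row_sum hg ng (i := 1) isT.
have r1V : 1 + a^-1 + b^-1 + x^-1 + y^-1 = 0 := row_sumV hg ng (i := 1) isT.
have [xy0 yE xE] : [/\ x + y != 0, g 2 3 = y & g 2 4 = x].
  exact: circulant_corner_rows.
have o12 : 1 + a / b + b / a + x / y + y / x = 0.
  rewrite -{1}yE -[X in y / X]xE {1}bc {2}ad.
  exact: (row_orth hg ng (i := 1) (k := 2)).
have c1 : 1 + a + b + x + g 4 1 = 0.
  by rewrite bc xp; apply: (row_sum hg' ng' (i := 1)).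
have y41 : g 4 1 = y by apply: (addrI (1 + a + b + x)); rewrite c1 r1.
have [_ y32 x42] : [/\ x + y != 0, g 3 2 = y & g 4 2 = x].
  by rewrite xp -y41; apply: (circulant_corner_rows hg' ng').
have swap4 (p q s t : C) : 1 + p + q + s + t = 1 + s + t + p + q by ring.
(* The pairs a, b and x, y exchange their roles; only the nonvanishing of a + b is kept. *)
have [ab0 _ _] : [/\ a + b != 0, b = b & a = a].
  apply: (@swapped_pair _ x y a b b a); rewrite ?g1 //.
  - by rewrite swap4.
  - by rewrite swap4.
  - by rewrite -r1; ring.
  - by rewrite -r1V; ring.
  - by rewrite swap4.
have r3 : 1 + x + y + g 3 3 + g 3 4 = 0.
  by rewrite xp -y32; apply: (row_sum hg ng (i := 3)).
have r3V : 1 + x^-1 + y^-1 + (g 3 3)^-1 + (g 3 4)^-1 = 0.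
  by rewrite xp -y32; apply: (row_sumV hg ng (i := 3)).
have c3 : 1 + x + y + g 3 3 + g 4 3 = 0.
  by rewrite -yE; apply: (row_sum hg' ng' (i := 3)).
have c4 : 1 + y + x + g 3 4 + g 4 4 = 0.
  by rewrite -xE; apply: (row_sum hg' ng' (i := 4)).
have g43 : g 4 3 = g 3 4 by apply: (addrI (1 + x + y + g 3 3)); rewrite c3 r3.
have g44 : g 4 4 = g 3 3.
  apply: (addrI (1 + x + y + g 3 4)); transitivity (0 : C).
    by rewrite -c4; ring.
  by rewrite -r3; ring.
have o13 : 1 + a / x + b / y + x / g 3 3 + y / g 3 4 = 0.
  by rewrite {1}xp -{1}y32; apply: (row_orth hg ng (i := 1) (k := 3)).
have o31 : 1 + x / a + y / b + g 3 3 / x + g 3 4 / y = 0.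
  by rewrite {1}xp -{1}y32; apply: (row_orth hg ng (i := 3) (k := 1)).
have o14 : 1 + a / y + b / x + x / g 3 4 + y / g 3 3 = 0.
  rewrite -[in a / y]y41 -[in b / x]x42 -g43 -[X in y / X]g44.
  exact: (row_orth hg ng (i := 1) (k := 4)).
have blk : g 3 3 = a /\ g 3 4 = b \/ g 3 3 = b /\ g 3 4 = a.
  rewrite swap4 in r1; rewrite swap4 in r1V.
  by apply: pair_eq_of_sums;
    rewrite ?nz ?ab0 ?(last_two_of_sum r3) ?(last_two_of_sum r3V)
      ?(last_two_of_sum r1) ?(last_two_of_sum r1V).
(* A coincidence turns an orthogonality relation, or a combination of several, into 3 + u / v + v /
   u = 0 with u and v unimodular. *)
have uabxy : uniq [:: a; b; x; y].
  have uvN (u v : C) := neq_ratio_unimodular (C := C) (u := u) (v := v).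
  have nab : a != b.
    apply/eqP => ab; apply: (uvN x y); rewrite ?g1 //.
    by rewrite -o12 ab !divff ?nz //; ring.
  have nxy : x != y.
    apply/eqP => exy; apply: (uvN a b); rewrite ?g1 //.
    by rewrite -o12 exy !divff ?nz //; ring.
  have sum3 (u v w : C) : `|u| = 1 -> `|v| = 1 -> w != 0 ->
      1 + u / w + w / u + v / w + w / v = 0 ->
      2 + u / w + w / v + v / u = 0 -> 2 + w / u + v / w + u / v = 0 -> False.
    (* The sum of [f] and [f'] minus [e] is 3 + u / v + v / u; this combination serves the second
       form of the block. *)
    move=> u1 v1 w0 e f f'; apply: (uvN u v u1 v1).
    rewrite -[RHS](subrr 0) -{1}[0](addr0 0) -{1}f -{1}f' -e.
    by ring.
  have : [/\ a != x, a != y, b != x & b != y].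
    case: blk => [[e f]|[e f]]; rewrite e f in o13 o31 o14.
      split; apply/eqP => uv.
      - by apply: (uvN b y); rewrite ?g1 // -o13 uv !divff ?nz //; ring.
      - by apply: (uvN b x); rewrite ?g1 // -o14 uv !divff ?nz //; ring.
      - by apply: (uvN a y); rewrite ?g1 // -o14 uv !divff ?nz //; ring.
      - by apply: (uvN a x); rewrite ?g1 // -o13 uv !divff ?nz //; ring.
    split; apply/eqP => uv; rewrite uv ?divff ?nz // in o12 o13 o31.
    - by apply: (@sum3 y b x); rewrite ?g1 ?nz //;
        [rewrite -o12|rewrite -o13|rewrite -o31]; ring.
    - by apply: (@sum3 b x y); rewrite ?g1 ?nz //;
        [rewrite -o12|rewrite -o13|rewrite -o31]; ring.
    - by apply: (@sum3 a y x); rewrite ?g1 ?nz //;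
        [rewrite -o12|rewrite -o13|rewrite -o31]; ring.
    - by apply: (@sum3 x a y); rewrite ?g1 ?nz //;
        [rewrite -o12|rewrite -o13|rewrite -o31]; ring.
  by rewrite /= !inE !negb_or nab nxy => -[-> -> -> ->].
have key : [/\ a ^+ 5 = 1, b ^+ 5 = 1, x ^+ 5 = 1 & y ^+ 5 = 1].
  (* The corner in rows 1, 2 and columns 1, k is moved into place by a transposition of columns. *)
  have cd (k : 'I_5) : k != 0 -> k != 1 ->
      [\/ g 1 k = b, a * g 2 k = g 1 k | a * g 2 k = b] /\
      [\/ a = g 2 k, g 1 k * b = a | g 1 k * b = g 2 k].
    move=> k0 k1; have := corner_dichotomy5 (hadamard5_perm 1%g (tperm 2 k) hg).
    have t1 : tperm 2 k 1 = 1 by rewrite tpermD.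
    have t0 : tperm 2 k 0 = 0 by rewrite tpermD.
    rewrite /= !perm1 t1 tpermL -/a -bc; apply.
    by split=> i; rewrite perm1 ?t0 ?(proj1 ng) ?(proj2 ng).
  have [cx cx'] := cd 3 isT isT; have [cy cy'] := cd 4 isT isT.
  rewrite yE in cx cx'; rewrite xE in cy cy'.
  exact: (cyclic_monomials (g1 1 1) (g1 1 2) (g1 1 3) (g1 1 4)).
case: key => a5 b5 x5 y5.
elim/ord5_ind; elim/ord5_ind; rewrite ?(proj1 ng) ?(proj2 ng) ?expr1n //.
- by rewrite -bc.
- by rewrite -ad.
- by rewrite yE.
- by rewrite xE.
- by rewrite -xp.
- by rewrite y32.
- by case: blk => [[-> _]|[-> _]].
- by case: blk => [[_ ->]|[_ ->]].
- by rewrite y41.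
- by rewrite x42.
- by rewrite g43; case: blk => [[_ ->]|[_ ->]].
- by rewrite g44; case: blk => [[-> _]|[-> _]].
Qed.

(** Row 1 and column 1 both begin with 1, a, b, so their last two entries agree up to order;
    exchanging rows 3 and 4 aligns them if necessary. *)
Lemma circulant_corner (C : numFieldType) (g : 'I_5 -> 'I_5 -> C) :
  hadamard5 g -> normal5 g -> g 1 1 = g 2 2 -> g 1 2 = g 2 1 ->
  forall i j, g i j ^+ 5 = 1.
Proof.
move=> hg ng ad bc; have nz i j : g i j != 0 by apply: hadamard5_neq0.
have [hg' ng'] := (hadamard5_tr hg, normal5_tr ng).
have [xy0 _ _] := circulant_corner_rows hg ng ad bc.
have [//||[xp _]|[_ xp]] := pair_eq_of_sums (nz 1 3) (nz 1 4) (nz 3 1) (nz 4 1) xy0.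
- rewrite (last_two_of_sum (row_sum hg ng (i := 1) isT)) bc.
  by rewrite (last_two_of_sum (row_sum hg' ng' (i := 1) isT)).
- rewrite (last_two_of_sum (row_sumV hg ng (i := 1) isT)) bc.
  by rewrite (last_two_of_sum (row_sumV hg' ng' (i := 1) isT)).
- exact: aligned_circulant_corner.
have t0 : tperm 3 4 0 = 0 :> 'I_5 by rewrite tpermD.
have t1 : tperm 3 4 1 = 1 :> 'I_5 by rewrite tpermD.
have t2 : tperm 3 4 2 = 2 :> 'I_5 by rewrite tpermD.
move=> i j; have := aligned_circulant_corner (hadamard5_perm (tperm 3 4) 1%g hg).
rewrite /= !perm1 t1 t2 tpermL => /(_ _ ad bc (esym xp) (tperm 3 4 i) j).
rewrite perm1 tpermK; apply.
by split=> k; rewrite perm1 ?t0 ?(proj1 ng) ?(proj2 ng).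
Qed.

(** * Change of base row and base column *)

(** The two hypotheses are the equations of a circulant corner after dephasing at row [s 0] and
    column [t 0], cleared of denominators. *)
Lemma root5_of_base_change (C : numFieldType) (h : 'I_5 -> 'I_5 -> C) (s t : 'S_5) :
  hadamard5 h -> normal5 h ->
  h (s 1) (t 1) * h (s 2) (t 0) * h (s 0) (t 2) =
    h (s 2) (t 2) * h (s 1) (t 0) * h (s 0) (t 1) ->
  h (s 1) (t 2) * h (s 2) (t 0) * h (s 0) (t 1) =
    h (s 2) (t 1) * h (s 1) (t 0) * h (s 0) (t 2) ->
  forall i j, h i j ^+ 5 = 1.
Proof.
move=> hh [h0 h0'] odd_eq even_eq.
have nz i j : h i j != 0 by apply: hadamard5_neq0.
have hst := hadamard5_perm s t hh.
have root := circulant_corner (hadamard5_dephase hst) (normal5_dephase hst).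
have {}root : forall i j, dephase (fun i j => h (s i) (t j)) i j ^+ 5 = 1.
  apply: root; rewrite /dephase.
    apply/eqP; rewrite eqr_div ?mulf_neq0 // -subr_eq0; apply/eqP.
    transitivity (h (s 0) (t 0) * (h (s 1) (t 1) * h (s 2) (t 0) * h (s 0) (t 2)
       - h (s 2) (t 2) * h (s 1) (t 0) * h (s 0) (t 1))); first by ring.
    by rewrite odd_eq subrr mulr0.
  apply/eqP; rewrite eqr_div ?mulf_neq0 // -subr_eq0; apply/eqP.
  transitivity (h (s 0) (t 0) * (h (s 1) (t 2) * h (s 2) (t 0) * h (s 0) (t 1)
     - h (s 2) (t 1) * h (s 1) (t 0) * h (s 0) (t 2))); first by ring.
  by rewrite even_eq subrr mulr0.
have {}root i j : (h i j * h (s 0) (t 0) / (h i (t 0) * h (s 0) j)) ^+ 5 = 1.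
  by have := root (s^-1 i)%g (t^-1 j)%g; rewrite /dephase !permKV.
move=> i j.
(* Dephasing back at row 0 and column 0 recovers [h]. *)
have -> : h i j =
    (h i j * h (s 0) (t 0) / (h i (t 0) * h (s 0) j)) *
    (h 0 0 * h (s 0) (t 0) / (h 0 (t 0) * h (s 0) 0)) /
    ((h i 0 * h (s 0) (t 0) / (h i (t 0) * h (s 0) 0)) *
     (h 0 j * h (s 0) (t 0) / (h 0 (t 0) * h (s 0) j))).
  by rewrite !h0 !h0'; field; rewrite !nz.
have quot (p q u v : C) : p ^+ 5 = 1 -> q ^+ 5 = 1 -> u ^+ 5 = 1 -> v ^+ 5 = 1 ->
    (p * q / (u * v)) ^+ 5 = 1.
  by move=> p5 q5 u5 v5; rewrite expr_div_n !exprMn p5 q5 u5 v5 !mulr1 divr1.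
by apply: quot; apply: root.
Qed.

(** An even and an odd permutation of three letters agree at exactly one letter. For the even and
    the odd product left out of the two coincidences, this common entry is the base at which the
    corner becomes circulant. *)
Lemma hadamard5_root5 (C : numFieldType) (h : 'I_5 -> 'I_5 -> C) :
  hadamard5 h -> normal5 h -> forall i j, h i j ^+ 5 = 1.
Proof.
move=> hh nh; have [ev od] := corner_dichotomy5 hh nh.
pose r0 : 'S_5 := 1%g.
pose r1 : 'S_5 := mulg (tperm 0 1) (tperm 0 2).
pose r2 : 'S_5 := mulg (tperm 0 2) (tperm 0 1).
have r00 i : r0 i = i by rewrite perm1.
have r10 : r1 0 = 1 by rewrite permM tpermL tpermD.
have r11 : r1 1 = 2 by rewrite permM tpermR tpermL.
have r12 : r1 2 = 0 by rewrite permM (@tpermD _ 0 1 2) // tpermR.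
have r20 : r2 0 = 2 by rewrite permM tpermL tpermD.
have r21 : r2 1 = 0 by rewrite permM (@tpermD _ 0 2 1) // tpermR.
have r22 : r2 2 = 1 by rewrite permM tpermR tpermL.
have rE := (r10, r11, r12, r20, r21, r22, r00).
have [h0 h0'] := nh.
(* Cyclic shifts of rows and of columns permute the nine cases transitively. *)
case: ev => e; case: od => o.
- apply: (root5_of_base_change (s := r0) (t := r0)) => //;
    by rewrite !rE !(h0, h0'); first [ring: e | ring: o].
- apply: (root5_of_base_change (s := r2) (t := r2)) => //;
    by rewrite !rE !(h0, h0'); first [ring: e | ring: o].
- apply: (root5_of_base_change (s := r1) (t := r1)) => //;
    by rewrite !rE !(h0, h0'); first [ring: e | ring: o].
- apply: (root5_of_base_change (s := r2) (t := r1)) => //;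
    by rewrite !rE !(h0, h0'); first [ring: e | ring: o].
- apply: (root5_of_base_change (s := r1) (t := r0)) => //;
    by rewrite !rE !(h0, h0'); first [ring: e | ring: o].
- apply: (root5_of_base_change (s := r0) (t := r2)) => //;
    by rewrite !rE !(h0, h0'); first [ring: e | ring: o].
- apply: (root5_of_base_change (s := r1) (t := r2)) => //;
    by rewrite !rE !(h0, h0'); first [ring: e | ring: o].
- apply: (root5_of_base_change (s := r0) (t := r1)) => //;
    by rewrite !rE !(h0, h0'); first [ring: e | ring: o].
- apply: (root5_of_base_change (s := r2) (t := r0)) => //;
    by rewrite !rE !(h0, h0'); first [ring: e | ring: o].
Qed.

(** * Fifth roots of unity *)

(** A root of 1 + X + X^2 + X^3 + X^4 has order dividing 5, and differs from 1 because 5 != 0. *)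
Lemma prim_root5_exists (C : closedFieldType) :
  (5%:R : C) != 0 -> exists w : C, 5.-primitive_root w.
Proof.
move=> five0; have [|w] := closed_rootP (\poly_(i < 5) (1 : C)) _.
  by rewrite size_poly_eq ?oner_eq0.
rewrite /root horner_poly => /eqP sw.
have w1 : w != 1.
  apply: contraNneq five0 => w1; rewrite -sw w1.
  under eq_bigr => i _ do rewrite mul1r expr1n.
  by rewrite sumr_const card_ord.
have w5 : w ^+ 5 = 1.
  have := subrX1 w 5; under [X in _ = _ * X]eq_bigr => i _ do rewrite -[w ^+ i]mul1r.
  by rewrite sw mulr0 => /eqP; rewrite subr_eq0 => /eqP.
exists w; have [m prim m5] := prim_order_exists (isT : 0 < 5)%N w5.
have : m \in divisors 5 by rewrite -dvdn_divisors.
rewrite !inE => /orP[]/eqP mE; last by rewrite mE in prim.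
by move: (prim_expr_order prim) w1; rewrite mE expr1 => ->; rewrite eqxx.
Qed.

(** For n != 0 the 5-adic valuation of the right side is odd, while that of a square is even. *)
Lemma five_squares (m n : int) : m ^+ 2 = 5 * n ^+ 2 -> n = 0.
Proof.
move=> /(congr1 absz); rewrite abszM !abszX => mn.
apply/eqP; rewrite -absz_eq0; apply: contraT; rewrite -lt0n => n0.
have : odd (logn 5 (5 * `|n| ^ 2)) by rewrite lognM ?expn_gt0 ?n0 // lognX oddD oddM.
by rewrite -mn lognX oddM.
Qed.

Lemma prim_root5_sum (C : fieldType) (w : C) :
  5.-primitive_root w -> 1 + w + w ^+ 2 + w ^+ 3 + w ^+ 4 = 0.
Proof.
move=> w5; have := subrX1 w 5; rewrite (prim_expr_order w5) subrr.
move=> /esym/eqP; rewrite mulf_eq0 => /orP[|].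
  rewrite subr_eq0 => /eqP w1.
  by have := eq_prim_root_expr w5 1 0; rewrite w1 expr1n eqxx.
by rewrite !big_ord_recr big_ord0 /= add0r expr0 expr1 => /eqP.
Qed.

(** Here (2 c + 1)^2 = 5, and the relation reads 2 m - n = - n (2 c + 1). *)
Lemma golden_irrational (C : numFieldType) (c : C) (m n : int) :
  c ^+ 2 + c = 1 -> m%:~R + n%:~R * c = 0 -> m = 0 /\ n = 0.
Proof.
move=> cE mn.
have n0 : n = 0.
  apply: (@five_squares (2 * m - n)).
  apply: (@intr_inj C); rewrite !(rmorphM, rmorphXn, rmorphB) /=.
  have mE : m%:~R = - (n%:~R * c) by apply/eqP; rewrite -addr_eq0 mn.
  have c2 : c ^+ 2 = 1 - c by rewrite -cE; ring.
  by rewrite mE; ring: c2.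
split=> //; move: mn; rewrite n0 mul0r addr0 => /eqP.
by rewrite intr_eq0 => /eqP.
Qed.

Lemma prim_root5_indep (C : numClosedFieldType) (w : C) (n : 'I_5 -> int) :
  5.-primitive_root w -> \sum_i (n i)%:~R * w ^+ i = 0 ->
  forall i, n i = n 0.
Proof.
move=> prim; rewrite sum_ord5 /= expr0 mulr1 expr1 => e.
have w5 : w ^+ 5 = 1 := prim_expr_order prim.
have sw := prim_root5_sum prim.
have wN : w^* = w ^+ 4.
  have w1 : `|w| = 1 by apply/eqP; rewrite -(@pexpr_eq1 _ _ 5) // -normrX w5 normr1.
  have w0 := unimodular_neq0 w1.
  by apply: (mulfI w0); rewrite -normCK w1 expr1n -exprS w5.
have e' : (n 0)%:~R + (n 1)%:~R * w ^+ 4 + (n 2)%:~R * w ^+ 3 + (n 3)%:~R * w ^+ 2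
    + (n 4)%:~R * w = 0.
  have := congr1 Num.conj e; rewrite rmorph0 => <-.
  rewrite !rmorphD /= !(rmorphXn, rmorphM) /= !rmorph_int wN.
  have -> : (w ^+ 4) ^+ 2 = w ^+ 3 by ring: w5.
  have -> : (w ^+ 4) ^+ 3 = w ^+ 2 by ring: w5.
  by have -> : (w ^+ 4) ^+ 4 = w by ring: w5.
have w4 : w ^+ 4 = - (1 + w + w ^+ 2 + w ^+ 3).
  by apply/eqP; rewrite -addr_eq0 addrC sw.
(* The sum and the difference of the relation and its conjugate are relations
   between 1 and c. *)
set c := w + w ^+ 4.
have c2 : c ^+ 2 + c = 1.
  apply/eqP; rewrite -subr_eq0 -[X in _ == X]sw; apply/eqP.
  by rewrite /c; ring: w5.
(* The sum is such a relation because w^2 + w^3 = - 1 - c. *)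
have [d1 d2] : 2 * n 0 - (n 2 + n 3) = 0 /\ (n 1 + n 4) - (n 2 + n 3) = 0.
  apply: (golden_irrational c2).
  rewrite !(rmorphB, rmorphD, rmorphM) /=.
  rewrite -[RHS](addr0 0) -{1}e -e' /c w4; ring.
(* Since w^2 - w^3 = c (w - w^4), the difference is w - w^4 times such a relation. *)
have [d3 d4] : n 1 - n 4 = 0 /\ n 2 - n 3 = 0.
  apply: (golden_irrational c2).
  have ww4 : w - w ^+ 4 != 0.
    rewrite subr_eq0 -{1}[w]expr1.
    by rewrite (eq_prim_root_expr prim).
  apply: (mulfI ww4); rewrite mulr0 -[RHS](subrr 0) -{1}e -e' /c !rmorphB /=.
  ring: w5.
elim/ord5_ind; lia.
Qed.

(** * Exponent tables *)

Lemma char_poly_tr (R : comNzRingType) n (A : 'M[R]_n) : char_poly A^T = char_poly A.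
Proof.
rewrite /char_poly -[RHS]det_tr; congr (\det _).
by apply/matrixP => i j; rewrite !mxE eq_sym.
Qed.

Lemma char_poly_perm (R : comNzRingType) n (A : 'M[R]_n) (s : 'S_n) :
  char_poly (\matrix_(i, j) A (s i) (s j)) = char_poly A.
Proof.
rewrite /char_poly.
have -> : char_poly_mx (\matrix_(i, j) A (s i) (s j)) =
    row_perm s (col_perm s (char_poly_mx A)).
  by apply/matrixP => i j; rewrite !mxE (inj_eq perm_inj).
rewrite row_permE col_permE !det_mulmx !det_perm.
by rewrite odd_permV mulrCA -signr_addb addbb mulr1.
Qed.

Lemma sum_exp_hist (F : pzRingType) (w : F) (I : finType) n (f : I -> 'I_n) :
  \sum_j w ^+ f j = \sum_i (#|[pred j | f j == i]|)%:~R * w ^+ i.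
Proof.
rewrite (partition_big f xpredT) //=; apply: eq_bigr => i _.
under eq_bigr => j /eqP -> do [].
by rewrite sumr_const mulr_natl.
Qed.

Lemma sum_card_fibers (I J : finType) (f : I -> J) :
  (\sum_i #|[pred j | f j == i]| = #|I|)%N.
Proof.
rewrite -[RHS]sum1_card (partition_big f xpredT) //=; apply: eq_bigr => i _.
by rewrite -sum1_card; apply: eq_bigl.
Qed.

(** By independence all five values are taken equally often, hence once each. *)
Lemma sum_exp_eq0 (C : numClosedFieldType) (w : C) (f : 'I_5 -> 'I_5) :
  5.-primitive_root w -> \sum_j w ^+ f j = 0 -> injective f.
Proof.
move=> prim; rewrite sum_exp_hist.
move=> /(prim_root5_indep (n := fun i => #|[pred j | f j == i]|%:Z) prim) cst.
have tot := sum_card_fibers f.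
have card1 i : (#|[pred j | f j == i]| = 1)%N.
  have cst' k : #|[pred j | f j == k]| = #|[pred j | f j == 0]| by have [] := cst k.
  move: tot; rewrite cst'.
  rewrite (eq_bigr (fun=> #|[pred j | f j == 0]|)) => [|k _]; last exact: cst'.
  rewrite sum_nat_const card_ord => /eqP.
  by rewrite -[X in _ == X]muln1 eqn_mul2l => /eqP.
move=> j k fjk; apply: (card_le1_eqP (A := [pred j | f j == f k])); rewrite ?card1 ?inE ?fjk //.
Qed.

(** The differences of multiplicities are all equal by independence, and they add up to 0. *)
Lemma sum_exp_eq (C : numClosedFieldType) (w : C) (f g : 'I_5 -> 'I_5) :
  5.-primitive_root w -> \sum_j w ^+ f j = \sum_j w ^+ g j ->
  perm_eq (codom f) (codom g).
Proof.
move=> prim /eqP; rewrite -subr_eq0 !sum_exp_hist -sumrB => /eqP fg.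
pose d i := #|[pred j | f j == i]|%:Z - #|[pred j | g j == i]|%:Z.
have cst : forall i, d i = d 0.
  apply: (prim_root5_indep prim); rewrite -[RHS]fg.
  by apply: eq_bigr => i _; rewrite rmorphB mulrBl.
have d0 i : d i = 0.
  have : \sum_i d i = 0.
    by rewrite sumrB -!(big_morph _ PoszD (erefl 0%:Z)) !sum_card_fibers subrr.
  rewrite (eq_bigr (fun=> d 0)) => [|k _]; last exact: cst.
  by rewrite sumr_const card_ord cst => /eqP; rewrite mulrn_eq0 => /eqP.
have cnt (u : 'I_5 -> 'I_5) x : count_mem x (codom u) = #|[pred j | u j == x]|.
  by rewrite codomE count_map cardE size_filter enumT.
apply/allP => x _ /=; rewrite !cnt.
by move/eqP: (d0 x); rewrite subr_eq0.
Qed.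

Definition entry (M : seq (seq nat)) i j : nat := nth 0%N (nth [::] M i) j.

Definition table (f : nat -> nat -> nat) := mkseq (fun i => mkseq (f i) 5) 5.

(** The candidates for the rows after the first; the same lists serve as the relabelings of indices
    that fix 0. *)
Definition rows := [seq 0%N :: r | r <- permutations [:: 1; 2; 3; 4]%N].

(** Orthogonality of the rows of powers of a primitive fifth root. Adding 5 first keeps the
    truncated subtraction exact. *)
Definition orth_rows (r s : seq nat) :=
  uniq [seq ((5 + x.1 - x.2) %% 5)%N | x <- zip r s].

Definition extend (Ms : seq (seq (seq nat))) :=
  [seq rcons M r | M <- Ms, r <- [seq r <- rows | all (orth_rows r) M]].

Definition exponent_tables := iter 4 extend [:: [:: nseq 5 0%N]].

Definition relabel p M := table (fun i j => entry M (nth 0%N p i) (nth 0%N p j)).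

Definition transpose M := table (fun i j => entry M j i).

Definition diagonal M := mkseq (fun i => entry M i i) 5.

(** A finite check over all pairs of tables; the [if] confines the search of the orbit to pairs with
    matching diagonals. *)
Lemma table_conj M N : M \in exponent_tables -> N \in exponent_tables ->
  perm_eq (diagonal M) (diagonal N) ->
  exists2 p, p \in rows & N = relabel p M \/ N = relabel p (transpose M).
Proof.
pose orb M := [seq relabel p M | p <- rows] ++ [seq relabel p (transpose M) | p <- rows].
have : all (fun M => let o := orb M in
    all (fun N => if perm_eq (diagonal M) (diagonal N) then N \in o else true)
      exponent_tables) exponent_tables.
  by vm_compute.
move=> /allP/[apply]/allP/[apply] orbP MN; move: orbP; rewrite /= MN mem_cat.
by case/orP=> /mapP[p pr ->]; exists p; auto.
Qed.

Lemma entry_table f (i j : 'I_5) : entry (table f) i j = f i j.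
Proof. by rewrite /entry nth_mkseq // nth_mkseq. Qed.

Definition exponent_table (e : 'I_5 -> 'I_5 -> 'I_5) :=
  table (fun i j => e (inord i) (inord j)).

Lemma entry_exponent_table e (i j : 'I_5) : entry (exponent_table e) i j = e i j.
Proof. by rewrite entry_table !inord_val. Qed.

Lemma diagonal_exponent_table e :
  diagonal (exponent_table e) = [seq val i | i <- codom (fun i => e i i)].
Proof.
rewrite /diagonal /mkseq -[iota 0 5](val_enum_ord 5) -!map_comp -enumT.
by apply: eq_map => i /=; rewrite entry_exponent_table.
Qed.

(** Comparison with the zero row makes every other row a permutation starting with 0; comparison of
    any two rows gives [orth_rows]. *)
Lemma exponent_table_rows (e : 'I_5 -> 'I_5 -> 'I_5) :
  (forall j, e 0 j = 0) -> (forall i, e i 0 = 0) ->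
  (forall i k, i != k -> injective (fun j => e i j - e k j)) ->
  exponent_table e \in exponent_tables.
Proof.
move=> e0 e0' einj.
pose r i := mkseq (fun j => e (inord i) (inord j) : nat) 5.
have rowsP i : (0 < i < 5)%N -> r i \in rows.
  move=> /andP[i0 i5].
  have ri : perm_eq (r i) (iota 0 5).
    have ur : uniq (r i).
      apply/mkseq_uniqP => j k j5 k5 /val_inj ejk.
      have ne : inord i != 0 :> 'I_5 by rewrite -val_eqE /= inordK // -lt0n.
      have := einj (inord i) 0 ne (inord j) (inord k).
      by rewrite /= ejk !e0 => /(_ erefl)/(congr1 val); rewrite /= !inordK.
    have sub : {subset r i <= iota 0 5}.
      by move=> x /mapP[j _ ->]; rewrite mem_iota /=.
    have [//|_ eqr] := uniq_min_size ur sub.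
    exact: uniq_perm ur (iota_uniq _ _) eqr.
  have rE : r i = 0%N :: behead (r i).
    rewrite /r /mkseq /=; congr (_ :: _).
    by rewrite (_ : inord 0 = 0) ?e0' //; apply: val_inj; rewrite /= inordK.
  rewrite rE; apply/mapP; exists (behead (r i)) => //.
  by rewrite mem_permutations -(perm_cons 0%N) -rE.
have orthP i k : (i < 5)%N -> (k < 5)%N -> i != k -> orth_rows (r i) (r k).
  move=> i5 k5 ik; rewrite /orth_rows /r /mkseq zip_map -map_comp.
  rewrite -/(mkseq _ 5); apply/mkseq_uniqP => j l j5 l5 /= ejl.
  have ne : inord i != inord k :> 'I_5 by rewrite -val_eqE /= !inordK.
  have := einj _ _ ne (inord j) (inord l).
  have subE (x y : 'I_5) : ((5 + x - y) %% 5)%N = (x - y)%R :> nat.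
    by rewrite /= modnDmr addnBA ?(ltnW (ltn_ord y)) // [(5 + x)%N]addnC.
  rewrite !subE in ejl.
  by move=> /(_ (val_inj ejl))/(congr1 val); rewrite /= !inordK.
(* The search starts from the zero row, so k rounds of extension produce k + 1 rows. *)
suff : forall k, (k < 5)%N -> mkseq r k.+1 \in iter k extend [:: [:: nseq 5 0%N]].
  by move=> /(_ 4 isT).
elim=> [_|k IHk k5].
  have r0 : r 0%N = nseq 5 0%N.
    by rewrite /r /mkseq /= (_ : inord 0 = 0) ?e0 //; apply: val_inj; rewrite /= inordK.
  by rewrite /mkseq /= r0 inE.
rewrite mkseqS /=; apply/allpairsPdep; exists (mkseq r k.+1), (r k.+1).
split=> //; first exact/IHk/ltnW.
rewrite mem_filter rowsP ?andbT //; apply/allP => _ /mapP[m + ->].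
rewrite mem_iota /= add0n => mk; apply: orthP => //.
  exact: leq_trans mk (ltnW k5).
by rewrite gtn_eqF.
Qed.

Lemma rows_perm p : p \in rows ->
  exists s : 'S_5, forall i : 'I_5, nth 0%N p i = s i.
Proof.
case/mapP=> r; rewrite mem_permutations -(perm_cons 0%N) => rp pE.
have {}rp : perm_eq p (iota 0 5) by rewrite pE.
have szp : size p = 5 by rewrite (perm_size rp).
have p5 (i : 'I_5) : (nth 0 p i < 5)%N.
  have : nth 0%N p i \in iota 0 5 by rewrite -(perm_mem rp) mem_nth ?szp.
  by rewrite mem_iota.
have inj : injective (fun i : 'I_5 => Ordinal (p5 i)).
  move=> i j /(congr1 val) /= /eqP; rewrite nth_uniq ?szp // => [/eqP/val_inj//|].
  by rewrite (perm_uniq rp) iota_uniq.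
by exists (perm inj) => i; rewrite permE.
Qed.

(** * From Hadamard matrices to exponent tables *)

(** At modulus 1 the conjugate is the inverse, so 5 times an off-diagonal entry of either unitarity
    relation is a sum of quotients. *)
Lemma hadamard5_scale (C : numClosedFieldType) (A : 'M[C]_5) :
  hadamard A -> hadamard5 (fun i j => sqrtC 5 * A i j).
Proof.
move=> [/unitarymx_two_sided[AA' A'A] A1].
have s0 : sqrtC 5 != 0 :> C by rewrite sqrtC_eq0 pnatr_eq0.
have h1 i j : `|sqrtC 5 * A i j| = 1.
  by rewrite normrM A1 ger0_norm ?sqrtC_ge0 ?ler0n // mulrC divfK.
have inv i j : (sqrtC 5 * A i j)^-1 = sqrtC 5 * (A i j)^*.
  have s1 : (sqrtC 5)^* = sqrtC 5 :> C by apply/CrealP; rewrite realE sqrtC_ge0 ler0n.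
  by rewrite invC_norm h1 expr1n invr1 mul1r rmorphM /= s1.
split=> // [i k ik|j l jl].
  have := congr1 (fun M : 'M_5 => 5 * M i k) AA'; rewrite !mxE (negPf ik) mulr0 => e.
  rewrite -[RHS]e mulr_sumr; apply: eq_bigr => j _; rewrite inv !mxE.
  by rewrite -[5 in RHS]sqrtCK; ring.
have := congr1 (fun M : 'M_5 => 5 * M l j) A'A.
rewrite !mxE eq_sym (negPf jl) mulr0 => e.
rewrite -[RHS]e mulr_sumr; apply: eq_bigr => i _; rewrite inv !mxE.
by rewrite -[5 in RHS]sqrtCK; ring.
Qed.

Lemma normal5_scale (C : numClosedFieldType) (A : 'M[C]_5) :
  dephased A -> normal5 (fun i j => sqrtC 5 * A i j).
Proof.
have s0 : sqrtC 5 != 0 :> C by rewrite sqrtC_eq0 pnatr_eq0.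
by case=> A0 A0'; split=> k; rewrite ?A0 ?A0' mulrC divfK.
Qed.

Lemma exponents (C : numClosedFieldType) (w : C) (A : 'M[C]_5) :
  5.-primitive_root w -> hadamard A -> dephased A ->
  exists2 e : 'I_5 -> 'I_5 -> 'I_5, exponent_table e \in exponent_tables &
    forall i j, sqrtC 5 * A i j = w ^+ e i j.
Proof.
move=> prim /hadamard5_scale hh /normal5_scale nh.
set h := fun i j => sqrtC 5 * A i j in hh nh *.
have r5 := hadamard5_root5 hh nh.
pose e i j := sval (prim_rootP prim (r5 i j)).
have he i j : h i j = w ^+ e i j by rewrite /e; case: prim_rootP.
exists e => //.
have w0 : w != 0 by rewrite (prim_root_eq0 prim).
have we1 (x : 'I_5) : w ^+ x = 1 -> x = 0.
  move=> wx; have := eq_prim_root_expr prim x 0.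
  by rewrite wx eqxx mod0n modn_small // => /esym/eqP x0; apply: val_inj.
apply: exponent_table_rows => [j|i|i k ik].
- by apply: we1; rewrite -he (proj1 nh).
- by apply: we1; rewrite -he (proj2 nh).
(* A quotient of entries is w to the difference of exponents in ['I_5], so row orthogonality is a
   vanishing sum of powers of w. *)
apply: (sum_exp_eq0 prim); have [_ hr _] := hh; rewrite -[RHS](hr i k ik).
apply: eq_bigr => j _; rewrite !he /= (prim_expr_mod prim) exprD (prim_expr_mod prim).
by congr (_ * _); apply: (mulIf (expf_neq0 (e k j) w0)); 
  rewrite mulVf ?expf_neq0 // -exprD subnK ?(prim_expr_order prim) // ltnW.
Qed.

Theorem theorem2 (R : realType) (A B : 'M[R[i]]_5)
    (hadA : hadamard A) (hadB : hadamard B)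
    (depA : dephased A) (depB : dephased B)
    (trAB : \tr A = \tr B) :
  spectrally_equivalent A B.
Proof.
have [w prim] : exists w : R[i], 5.-primitive_root w.
  by apply: prim_root5_exists; rewrite pnatr_eq0.
have s0 : sqrtC 5 != 0 :> R[i] by rewrite sqrtC_eq0 pnatr_eq0.
have [eA tabA hA] := exponents prim hadA depA.
have [eB tabB hB] := exponents prim hadB depB.
(* Up to the factor [sqrtC 5], the traces are sums of powers of w, and these determine the diagonal
   exponents up to order. *)
have diag : perm_eq (diagonal (exponent_table eA)) (diagonal (exponent_table eB)).
  rewrite !diagonal_exponent_table perm_map // (sum_exp_eq prim) //.
  under eq_bigr do rewrite -hA; under [RHS]eq_bigr do rewrite -hB.
  by rewrite -!mulr_sumr; congr (_ * _).
have [p /rows_perm[s ps] BA] := table_conj tabA tabB diag.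
suff charAB : char_poly A = char_poly B by move=> z; rewrite /eigen_mult charAB.
have AE i j : A i j = w ^+ eA i j / sqrtC 5 by rewrite -hA mulrC mulKf.
have BE i j : B i j = w ^+ eB i j / sqrtC 5 by rewrite -hB mulrC mulKf.
(* Both matrices come from their tables by the same formula, so the relation between the tables
   carries over to the entries. *)
have [{}BA|{}BA] : (forall i j, B i j = A (s i) (s j)) \/
    (forall i j, B i j = A (s j) (s i)).
  case: BA => [BA|BA]; [left|right] => i j; rewrite AE BE; congr (_ ^+ _ / _);
    by rewrite -entry_exponent_table BA /relabel ?/transpose !entry_table !ps
      !entry_table !inord_val.
- by rewrite -(char_poly_perm A s); congr char_poly; apply/matrixP => i j; rewrite mxE BA.
- rewrite -char_poly_tr -(char_poly_perm A^T s); congr char_poly.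
  by apply/matrixP => i j; rewrite !mxE BA.
Qed.
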